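(* Let $\Delta \ge 3$ and let $\mathcal{G}$ be a family of finite connected graphs such that every $G \in \mathcal{G}$ has maximum degree at most $\Delta$. Let $0 < \varepsilon \le \Delta-2$, and suppose that $h(G) \ge \varepsilon$ for all sufficiently large $G \in \mathcal{G}$ (that is, for all $G\in\mathcal{G}$ whose order exceeds some constant). Then for all $G \in \mathcal{G}$, $$c(G) \le n^{\,1-\frac12\log_{\Delta-1}(1+\varepsilon/\Delta)+o(1)},$$ where $n=|V(G)|$ and $o(1)$ denotes a quantity bounded by a function of $n$ (depending only on $\mathcal{G},\Delta,\varepsilon$) that tends to $0$ as $n\to\infty$.
   Context: The isoperimetric number of a graph $G$ of order $n$ is $$h(G) = \min_{0<|S|\le n/2} \frac{|\delta S|}{|S|},$$ the minimum being over vertex sets $S \subseteq V(G)$ of the indicated sizes, where $\delta S$ is the set of edges with exactly one endpoint in $S$. The game of cops and robbers is played with perfect information on a finite connected (undirected) graph $G$. The first player controls a team of cops, the second player controls one robber. First the first player places each cop on a vertex (several cops may share a vertex), then the second player places the robber on a vertex. The players then alternate turns, the first player moving first. On her turn the first player moves each cop to a vertex of its closed neighborhood (each cop may stay put or move to an adjacent vertex); on his turn the second player moves the robber to a vertex of the closed neighborhood of its current vertex. The first player wins if at some point a cop occupies the same vertex as the robber; the second player wins if the robber avoids this forever. The cop number $c(G)$ is the smallest number of cops for which the first player has a winning strategy on $G$. *)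

(* Defs.v *)
From HB Require Import structures.
From mathcomp Require Import all_boot all_order all_algebra.
From mathcomp Require Import all_classical all_reals all_analysis.

Set Implicit Arguments.
Unset Strict Implicit.
Unset Printing Implicit Defensive.

Import Order.TTheory GRing.Theory Num.Theory.
Import numFieldNormedType.Exports.

Local Open Scope ring_scope.

Record sgraph := SGraph {
  vertex :> finType;
  adj : rel vertex;
  adj_sym : symmetric adj;
  adj_irrefl : irreflexive adj
}.

Definition graph_order (G : sgraph) : nat := #|G|.

Definition vdegree (G : sgraph) (v : G) : nat := #|[set w | adj v w]|.

Definition max_degree (G : sgraph) : nat := \max_(v : G) vdegree v.

(* The graph with no vertices is not considered connected. *)
Definition connected_graph (G : sgraph) : Prop :=
  (0 < graph_order G)%N /\ forall x y : G, connect (@adj G) x y.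

Definition edges (G : sgraph) : {set {set G}} :=
  [set [set p.1; p.2] | p : G * G & adj p.1 p.2].

Definition edge_boundary (G : sgraph) (S : {set G}) : {set {set G}} :=
  [set E in edges G | #|E :&: S| == 1%N].

(* Extended-real valued: the minimum is over an empty range, hence +oo, exactly
   when G has at most one vertex. *)
Definition isoperimetric_number (R : realType) (G : sgraph) : \bar R :=
  \big[Order.min/+oo%E]_(S : {set G} | (0 < #|S|)%N && (2 * #|S| <= graph_order G)%N)
     (#|edge_boundary S|%:R / #|S|%:R)%:E.

Definition closed_adj (G : sgraph) : rel G := fun x y => (x == y) || adj x y.
Arguments closed_adj {G}.

(* A strategy for k cops maps the list [:: r_0; ...; r_(t-1)] of the robber
   positions seen so far, oldest first, to the positions of the cops after their
   t-th move; its value at [::] is the initial placement.  The earlier cop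
   positions need not be recorded, being determined by the strategy itself. *)
Definition cop_strategy (G : sgraph) (k : nat) := seq G -> {ffun 'I_k -> G}.

Definition legal_strategy (G : sgraph) (k : nat) (s : cop_strategy G k) : Prop :=
  forall (h : seq G) (r : G) (i : 'I_k), closed_adj (s h i) (s (rcons h r) i).

Definition robber_play (G : sgraph) (r : nat -> G) : Prop :=
  forall t : nat, closed_adj (r t) (r t.+1).

(* A cop is met either when the robber is placed or moves (first disjunct), or
   when the cops answer that placement or move (second disjunct). *)
Definition captures (G : sgraph) (k : nat) (s : cop_strategy G k)
    (r : nat -> G) : Prop :=
  exists (t : nat) (i : 'I_k), s (mkseq r t) i = r t \/ s (mkseq r t.+1) i = r t.

Definition cops_win (G : sgraph) (k : nat) : Prop :=
  exists s : cop_strategy G k, legal_strategy s /\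
    forall r : nat -> G, robber_play r -> captures s r.

Lemma cops_win_ex (G : sgraph) : exists k : nat, `[< cops_win G k >].
Proof.
exists #|G|; apply/asboolP.
exists (fun _ => [ffun i => enum_val i]); split.
  by move=> h r i; rewrite /closed_adj !ffunE eqxx.
by move=> r _; exists 0%N, (enum_rank (r 0%N)); left; rewrite ffunE enum_rankK.
Qed.

Definition cop_number (G : sgraph) : nat := ex_minn (cops_win_ex G).

Definition logb (R : realType) (b x : R) : R := ln x / ln b.

(* Main.v *)
Require Import Defs.
From HB Require Import structures.
From mathcomp Require Import all_boot all_order all_algebra.
From mathcomp Require Import boolp reals sequences exp.
From mathcomp Require Import zify ring lra.
Import Order.TTheory GRing.Theory Num.Theory.

(* Write lam = 1 + eps/Delta, and let r be about half the logarithm of n in base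
   Delta - 1, so that balls of radius r have O(sqrt n) vertices.  If every subset
   A of the ball of radius r around the robber's initial position has at least
   #|A| cops within distance r, then by Hall's theorem distinct cops can be sent
   to all vertices of that ball in r moves, and they catch the robber, who has
   not left it.  By expansion the r-neighbourhood of A has at least
   lam ^ r * #|A| vertices up to a constant (or half of the graph, which is
   enough as #|A| = O(sqrt n)), so by a union bound O(n log n / lam ^ r)
   independent uniform cops satisfy all the Hall conditions simultaneously. *)

Set Implicit Arguments.
Unset Strict Implicit.
Unset Printing Implicit Defensive.

Local Open Scope ring_scope.

(** * Hall's marriage theorem *)

Section Hall.
Local Open Scope nat_scope.
Local Open Scope set_scope.
Variables T I : finType.

(* A matching of L into I is encoded by its partial inverse h, so that its
   injectivity needs no separate clause. *)
Lemma hall_marriage (N : T -> {set I}) (L : {set T}) :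
  (forall A : {set T}, A \subset L -> #|A| <= #|\bigcup_(u in A) N u|) ->
  exists h : I -> option T,
    forall u, u \in L -> exists2 i, i \in N u & h i = Some u.
Proof.
move: {2}#|L|.+1 (ltnSn #|L|) => n.
elim: n N L => // n IHn N L ltLn hallL.
have [->|[u Lu]] := set_0Vmem L.
  by exists (fun=> None) => u; rewrite inE.
have [/existsP[A /and3P[sAL A0 tightA]]|] :=
  boolP [exists A : {set T},
    [&& A \proper L, A != set0 & #|\bigcup_(w in A) N w| <= #|A|]].
(* Halmos-Vaughan: a tight proper subset A is matched inside its neighbourhood
   and L :\: A outside it; without one, any single edge may be used. *)
- set NA := \bigcup_(w in A) N w in tightA.
  have ltAL := proper_card sAL.
  have {}sAL := proper_sub sAL.
  have [|B sBA|h1 h1P] := IHn N A; first exact: leq_trans ltAL _.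
    by apply: hallL; apply: subset_trans sBA sAL.
  have [||h2 h2P] := IHn (fun w => N w :\: NA) (L :\: A).
  + apply: leq_trans (_ : #|L| <= n) => //; rewrite cardsD (setIidPr sAL).
    have A1 : 0 < #|A| by rewrite card_gt0.
    by rewrite ltn_subrL A1 (leq_ltn_trans _ ltAL).
  + move=> B sBLA.
    have dBA : [disjoint B & A].
      by move: sBLA; rewrite subsetD => /andP[].
    have sBL : B \subset L.
      by move: sBLA; rewrite subsetD => /andP[].
    (* The Hall condition of [B :|: A] gives that of [B] outside [NA]: tightness of [A] allows
       [#|A|] to be subtracted in place of [#|NA|]. *)
    have := hallL (B :|: A); rewrite subUset sBL sAL => /(_ isT).
    rewrite bigcup_setU cardsU disjoint_setI0 // cards0 subn0 -/NA.
    set NB := \bigcup_(w in B) N w.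
    have -> : \bigcup_(w in B) (N w :\: NA) = NB :\: NA.
      apply/setP => i; rewrite inE; apply/bigcupP/andP.
        by move=> [w Bw]; rewrite inE => /andP[? Nw]; split=> //; apply/bigcupP; exists w.
      by move=> [? /bigcupP[w Bw Nw]]; exists w; rewrite ?inE // Nw andbT.
    have -> : NB :|: NA = (NB :\: NA) :|: NA.
      by apply/setP => i; rewrite !inE; case: (i \in NA); rewrite ?orbT ?orbF.
    rewrite cardsU.
    have -> : (NB :\: NA) :&: NA = set0.
      by apply/setP => i; rewrite !inE; case: (i \in NA); rewrite ?andbF.
    rewrite cards0 subn0 => hBA.
    rewrite -(leq_add2r #|A|) (leq_trans hBA) //.
    by rewrite leq_add2l.
  exists (fun i => if i \in NA then h1 i else h2 i) => w Lw.
  have [Aw|nAw] := boolP (w \in A).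
    have [i Ni hi] := h1P w Aw; exists i => //.
    by rewrite ifT //; apply/bigcupP; exists w.
  have [|i] := h2P w; first by rewrite inE nAw.
  by rewrite inE => /andP[nNAi Ni] hi; exists i; rewrite // (negbTE nNAi).
- move=> /existsPn slackL.
  have [i Nui] : exists i, i \in N u.
    have := hallL [set u]; rewrite sub1set Lu big_set1 cards1 => /(_ isT).
    by rewrite card_gt0 => /set0Pn.
  have [||h hP] := IHn (fun w => N w :\ i) (L :\ u).
  + by move: ltLn; rewrite (cardsD1 u) Lu.
  + move=> B sBLu.
    have [->|B0] := eqVneq B set0; first by rewrite cards0.
    have pBL : B \proper L.
      by apply: sub_proper_trans sBLu _; rewrite properD1.
    have := slackL B; rewrite pBL B0 /= -ltnNge => slackB.
    have -> : \bigcup_(w in B) (N w :\ i) = (\bigcup_(w in B) N w) :\ i.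
      apply/setP => j; rewrite !inE; apply/bigcupP/andP.
        move=> [w Bw]; rewrite !inE => /andP[? Nw].
        by split=> //; apply/bigcupP; exists w.
      by move=> [? /bigcupP[w Bw Nw]]; exists w; rewrite ?inE // Nw andbT.
    (* The strict surplus of [B] pays for the removal of [i]. *)
    move: slackB; rewrite (cardsD1 i) => slackB.
    by rewrite -ltnS (leq_trans slackB) // -add1n leq_add2r leq_b1.
  exists (fun j => if j == i then Some u else h j) => w Lw.
  have [->|nwu] := eqVneq w u; first by exists i; rewrite ?eqxx.
  have [|j] := hP w; first by rewrite !inE nwu.
  by rewrite !inE => /andP[/negbTE nji Nj] hj; exists j; rewrite ?nji.
Qed.

End Hall.

(** * Balls and edge boundaries in graphs of bounded degree *)

Lemma leq_card_bigcup (I T : finType) (P : pred I) (F : I -> {set T}) :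
  (#|\bigcup_(i | P i) F i|%SET <= \sum_(i | P i) #|F i|)%N.
Proof.
apply: (big_rec2 (fun (A : {set T}) m => #|A| <= m)%N); first by rewrite cards0.
by move=> i m A _ hA; apply: leq_trans (leq_card_setU _ _) _; rewrite leq_add2l.
Qed.

Section Balls.
Local Open Scope nat_scope.
Local Open Scope set_scope.
Variable G : sgraph.
Implicit Types (S : {set G}) (x y u v : G).

Lemma closed_adj_sym x y : closed_adj x y = closed_adj y x.
Proof. by rewrite /closed_adj eq_sym adj_sym. Qed.

Definition cnbhd S : {set G} := [set y | [exists x in S, closed_adj x y]].

Definition gball S (r : nat) : {set G} := iter r cnbhd S.

Lemma cnbhdP S y : reflect (exists2 x, x \in S & closed_adj x y) (y \in cnbhd S).
Proof. by rewrite inE; apply: exists_inP. Qed.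

Lemma sub_cnbhd S : S \subset cnbhd S.
Proof. by apply/subsetP => x Sx; apply/cnbhdP; exists x; rewrite // /closed_adj eqxx. Qed.

Lemma sub_gball S r : S \subset gball S r.
Proof. by elim: r => // r IHr; apply: subset_trans IHr (sub_cnbhd _). Qed.

Lemma mem_gball1 S r y : y \in gball S r -> exists2 x, x \in S & y \in gball [set x] r.
Proof.
elim: r y => [|r IHr] y; first by exists y; rewrite ?inE.
move=> /cnbhdP[z /IHr[x Sx xz] zy]; exists x => //.
by apply/cnbhdP; exists z.
Qed.

(** The walk leads from [y] towards [S], the direction in which a cop travels; being infinite, it
    rests at its end after time [r]. *)
Lemma gball_walk S r y : y \in gball S r ->
  exists2 p : nat -> G, robber_play p & p 0 = y /\ p r \in S.
Proof.
elim: r y => [|r IHr] y.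
  by move=> Sy; exists (fun=> y) => // t; rewrite /closed_adj eqxx.
move=> /cnbhdP[z /IHr[p pP [p0 pr]] zy].
exists (fun t => if t is t'.+1 then p t' else y) => // -[|t] //=.
by rewrite p0 closed_adj_sym.
Qed.

Lemma robber_in_gball (r : nat -> G) t : robber_play r -> r t \in gball [set r 0] t.
Proof.
move=> rP; elim: t => [|t IHt]; first by rewrite inE.
by apply/cnbhdP; exists (r t).
Qed.

Lemma degree_le Delta v : max_degree G <= Delta -> vdegree v <= Delta.
Proof. by apply: leq_trans; apply: leq_bigmax. Qed.

Lemma card_new_vertices Delta v r : max_degree G <= Delta ->
  #|gball [set v] r.+2 :\: gball [set v] r.+1|
    <= Delta.-1 * #|gball [set v] r.+1 :\: gball [set v] r|.
Proof.
move=> hD.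
set B0 := gball _ r; set B1 := gball _ r.+1; set B2 := gball _ r.+2.
have sub : B2 :\: B1 \subset \bigcup_(z in B1 :\: B0) ([set w | adj z w] :\: B1).
  apply/subsetP => w; rewrite in_setD => /andP[nw1 /cnbhdP[z z1 zw]].
  have zw' : adj z w.
    by case/orP: zw => // /eqP zw; rewrite -zw z1 in nw1.
  apply/bigcupP; exists z; last by rewrite in_setD nw1 inE.
  rewrite in_setD z1 andbT; apply: contra nw1 => z0.
  by apply/cnbhdP; exists z.
apply: leq_trans (subset_leq_card sub) _.
apply: (leq_trans (leq_card_bigcup _ _)).
rewrite mulnC -sum_nat_const; apply: leq_sum => z.
rewrite in_setD => /andP[nz0 /cnbhdP[y y0 yz]].
have yz' : adj z y.
  by case/orP: yz => [/eqP yz|]; [rewrite -yz y0 in nz0 | rewrite adj_sym].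
(* The edge from z back to gball r leaves at most Delta - 1 edges forward. *)
have := degree_le z hD; rewrite /vdegree (cardsD1 y) inE yz' add1n => hz.
rewrite -ltnS; apply: leq_trans (_ : #|[set w | adj z w] :\ y|.+1 <= _).
  rewrite ltnS; apply: subset_leq_card; apply/subsetP => w.
  rewrite in_setD in_setD1 => /andP[nw1 ->]; rewrite andbT.
  apply: contra nw1 => /eqP->; exact: (subsetP (sub_cnbhd _)).
by apply: leq_trans hz _; apply: leqSpred.
Qed.

Lemma card_gball Delta v r : 3 <= Delta -> max_degree G <= Delta ->
  #|gball [set v] r| <= 3 * Delta.-1 ^ r.
Proof.
case: Delta => [//|[//|[//|d]]] _ hD /=.
have step t : #|gball [set v] t.+1 :\: gball [set v] t| <= d.+3 * d.+2 ^ t.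
  elim: t => [|t IHt].
    rewrite expn0 muln1; apply: leq_trans (degree_le v hD).
    apply: subset_leq_card; apply/subsetP => w.
    rewrite in_setD => /andP[nwv /cnbhdP[z]]; rewrite inE => /eqP-> /orP[/eqP vw|].
      by rewrite -vw inE eqxx in nwv.
    by rewrite inE.
  apply: leq_trans (card_new_vertices v t hD) _ => /=.
  by rewrite expnS mulnCA leq_mul2l IHt orbT.
(* Closed form of the geometric sum of the sphere sizes, cleared of the denominator [d.+1], which is
   [Delta - 2]. The factor 3 of the lemma bounds [Delta / (Delta - 2)]. *)
have main t : d.+1 * #|gball [set v] t| + 2 <= d.+3 * d.+2 ^ t.
  elim: t => [|t IHt]; first by rewrite cards1 expn0; lia.
  have -> : #|gball [set v] t.+1| =
      #|gball [set v] t| + #|gball [set v] t.+1 :\: gball [set v] t|.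
    by rewrite cardsD (setIidPr (sub_cnbhd _)) subnKC // subset_leq_card // sub_cnbhd.
  have := step t; rewrite expnS; nia.
have := main r; set b := #|_|; set e := _ ^ _ => hb.
rewrite -(leq_pmul2l (ltn0Sn d)); nia.
Qed.

(** Each boundary edge is charged to its endpoint outside [S], and a vertex is charged at most
    [Delta] times. *)
Lemma card_edge_boundary Delta S : max_degree G <= Delta ->
  #|edge_boundary S| <= Delta * #|cnbhd S :\: S|.
Proof.
move=> hD.
have sub : edge_boundary S \subset
    \bigcup_(w in cnbhd S :\: S) [set [set w; u] | u in [set u | adj w u]].
  apply/subsetP => E; rewrite inE => /andP[/imsetP[[x y] /= + ->]].
  rewrite inE /= => xy /cards1P[z Ez].
  have key a b : adj a b -> a \in S -> b \notin S ->
      b \in cnbhd S :\: S by move=> ab Sa nSb; rewrite inE nSb; apply/cnbhdP;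
      exists a; rewrite // /closed_adj ab orbT.
  have xneqy : x != y by apply: contraTneq xy => ->; rewrite adj_irrefl.
  have [Sx|nSx] := boolP (x \in S); have [Sy|nSy] := boolP (y \in S).
  - have : x \in [set z] by rewrite -Ez !inE eqxx Sx.
    have : y \in [set z] by rewrite -Ez !inE eqxx Sy orbT.
    by rewrite !inE => /eqP yz /eqP xz; rewrite xz yz eqxx in xneqy.
  - apply/bigcupP; exists y; first exact: key xy Sx nSy.
    by apply/imsetP; exists x; [rewrite inE adj_sym | rewrite setUC].
  - apply/bigcupP; exists x; first by apply: key Sy nSx; rewrite adj_sym.
    by apply/imsetP; exists y; rewrite ?inE.
  - have : z \in [set x; y] :&: S by rewrite Ez inE.
    by rewrite !inE => /andP[/orP[]/eqP->]; rewrite ?(negbTE nSx) ?(negbTE nSy).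
apply: leq_trans (subset_leq_card sub) _.
apply: (leq_trans (leq_card_bigcup _ _)).
rewrite mulnC -sum_nat_const; apply: leq_sum => w _.
exact: leq_trans (leq_imset_card _ _) (degree_le w hD).
Qed.

End Balls.

(** * From a placement of the cops to a winning strategy *)

Lemma robber_play_const (G : sgraph) (x : G) : robber_play (fun=> x).
Proof. by move=> t; rewrite /closed_adj eqxx. Qed.

Lemma cops_win_of_placement (G : sgraph) (r K : nat) (c : 'I_K -> G) :
  (forall (v : G) (A : {set G}), A \subset gball [set v] r ->
     (#|A| <= #|[set i | c i \in gball A r]|)%N) ->
  cops_win G K.
Proof.
move=> hc.
have route (v : G) : exists p : 'I_K -> nat -> G,
    [/\ forall i, robber_play (p i), forall i, p i 0%N = c i
      & forall u, u \in gball [set v] r -> exists i, p i r = u].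
  have [|h hP] := @hall_marriage _ _ (fun u : G => [set i | c i \in gball [set u] r])
                       (gball [set v] r).
    move=> A sA; apply: leq_trans (hc v A sA) _.
    apply: subset_leq_card; apply/subsetP => i; rewrite inE => /mem_gball1[u Au ciu].
    by apply/bigcupP; exists u; rewrite ?inE.
  (* A cop walks to the vertex it is matched with and otherwise stays put. The premise on [c i] is
     there because [h] may also assign [u] to cops too far away to reach it. *)
  have /boolp.choice[p pP] : forall i : 'I_K, exists p : nat -> G,
      [/\ robber_play p, p 0%N = c i
        & forall u, h i = Some u -> c i \in gball [set u] r -> p r = u].
    move=> i; case hi: (h i) => [u|]; last first.
      by exists (fun=> c i); split=> //; exact: robber_play_const.
    have [/gball_walk[p pw [p0 pr]]|nci] := boolP (c i \in gball [set u] r).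
      by exists p; split=> // _ [<-] _; apply/set1P.
    exists (fun=> c i); split=> //; first exact: robber_play_const.
    by move=> _ [<-] ci; rewrite ci in nci.
  exists p; split=> [i|i|u /hP[i]]; [by have [] := pP i | by have [] := pP i |].
  by rewrite inE => ci hi; exists i; have [_ _] := pP i; apply.
have {route} [p pP] := boolp.choice route.
(* The cops only use the initial position of the robber and the time. *)
exists (fun s => [ffun i => if s is v :: _ then p v i (size s) else c i]); split.
  move=> [|v s] u i; rewrite !ffunE /=.
    by have [pw p0 _] := pP u; rewrite -(p0 i); apply: pw.
  by rewrite size_rcons; have [pw _ _] := pP v; apply: pw.
move=> q qw; have [_ p0 hit] := pP (q 0%N).
have [i pir] := hit _ (robber_in_gball r qw).
(* After [r] cop moves the ball is fully occupied, so the [r]-th move of the robber ends on a cop.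
   If [r] is 0, the history is empty and [p0] identifies the initial placement. *)
exists r, i; left; rewrite ffunE -pir.
by case: (r) => [|t] /=; rewrite ?size_map ?size_iota ?p0.
Qed.

Lemma cop_number_le (G : sgraph) (K : nat) : cops_win G K -> (cop_number G <= K)%N.
Proof.
by move=> GK; rewrite /cop_number; case: ex_minnP => m _; apply; apply/boolp.asboolP.
Qed.

(** One cop on each vertex, with radius 0. This serves the small orders, for which no expansion is
    assumed. *)
Lemma cop_number_le_order (G : sgraph) : (cop_number G <= graph_order G)%N.
Proof.
apply: cop_number_le; apply: (@cops_win_of_placement G 0 _ enum_val) => v A _ /=.
rewrite -(card_imset A enum_rank_inj); apply: subset_leq_card.
by apply/subsetP => _ /imsetP[x Ax ->]; rewrite inE enum_rankK.
Qed.

(** * Random placement of the cops *)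

Lemma sum_exp_card (R : comNzRingType) (V : finType) (q : R) :
  \sum_(A : {set V}) q ^+ #|A| = (1 + q) ^+ #|V|.
Proof.
transitivity (\prod_(i : V) (q + 1)); last by rewrite prodr_const addrC.
rewrite bigA_distr; apply: eq_bigr => A _.
by rewrite -big_mkcond /= prodr_const.
Qed.

Lemma prod_half_card (R : fieldType) (I : finType) (P : pred I) :
  \prod_i (if P i then 2^-1 else 1 : R) = 2^-1 ^+ #|[set i | P i]|.
Proof. by rewrite -big_mkcond /= prodr_const cardsE. Qed.

(** This is [#|V|] times the expected weight of one uniform cop, which weighs 1/2 when it lands in
    [T] and 1 otherwise. *)
Lemma sum_half_card (R : numFieldType) (V : finType) (T : {set V}) :
  \sum_x (if x \in T then 2^-1 else 1 : R) = #|V|%:R - #|T|%:R / 2.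
Proof.
rewrite (bigID (mem T)) /= (eq_bigr (fun=> 2^-1)) => [|x ->//].
rewrite [X in _ + X](eq_bigr (fun=> 1)) => [|x /negbTE->//].
rewrite !sumr_const -(cardC T) natrD -[2^-1 *+ _]mulr_natl.
have -> : #|[predC T]| = #|[pred i | i \notin T]| by apply: eq_card.
by field.
Qed.

(* First-moment method with the weight 2 ^ (#|A| - number of hits of T A), which
   is at least 1 on every violated A; q is the expected weight per element. *)
Lemma random_placement (R : realType) (V : finType) (F : pred {set V})
    (T : {set V} -> {set V}) (D : R) (K : nat) :
  (0 < #|V|)%N ->
  (forall A, F A -> A != set0) ->
  (forall A, F A -> D * #|A|%:R <= #|T A|%:R) ->
  4 * #|V|%:R * expR (- (D * K%:R / (2 * #|V|%:R))) <= 1 ->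
  exists c : {ffun 'I_K -> V},
    forall A, F A -> (#|A| <= #|[set i | c i \in T A]|)%N.
Proof.
move=> V0 F0 FT hq.
set n : R := #|V|%:R in hq *.
set q : R := 2 * expR (- (D * K%:R / (2 * n))).
have n0 : 0 < n by rewrite ltr0n.
have q0 : 0 < q by rewrite mulr_gt0 ?expR_gt0.
apply: contrapT => /forallNP bad.
pose w (A : {set V}) x : R := if x \in T A then 2^-1 else 1.
(* The expectation is kept as a sum over all [n ^+ K] placements; if all of them are bad, each
   contributes at least 1. *)
pose total : R := \sum_(c : {ffun 'I_K -> V})
  \sum_(A | F A) 2 ^+ #|A| * \prod_i w A (c i).
have lower : n ^+ K <= total.
  have -> : n ^+ K = \sum_(c : {ffun 'I_K -> V}) 1.
    by rewrite sumr_const card_ffun card_ord natrX.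
  apply: ler_sum => c _.
  have /existsNP[A /not_implyP[FA /negP]] := bad c.
  rewrite -ltnNge => hA.
  rewrite (bigD1 A) //= -[leLHS]addr0 lerD //.
    have -> : \prod_i w A (c i) = 2^-1 ^+ #|[set i | c i \in T A]|.
      exact: (prod_half_card R (fun i => c i \in T A)).
    rewrite exprVn ler_pdivlMr ?exprn_gt0 // mul1r.
    by rewrite ler_weXn2l ?ler1n // ltnW.
  apply: sumr_ge0 => B _; rewrite mulr_ge0 ?exprn_ge0 // prodr_ge0 // => i _.
  by rewrite /w; case: ifP; rewrite ?invr_ge0 ?ler0n ?ler01.
have upper : total <= n ^+ K * ((1 + q) ^+ #|V| - 1).
  rewrite /total exchange_big /=.
  apply: (@le_trans _ _ (\sum_(A | F A) n ^+ K * q ^+ #|A|)).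
    apply: ler_sum => A FA.
    (* Independence of the cops: the sum over placements is the [K]-th power of the sum for one
       cop. *)
    rewrite -big_distrr /= -(bigA_distr_bigA (fun=> w A)) prodr_const card_ord.
    rewrite [X in X ^+ K](sum_half_card R (T A)) -/n.
    have h : n - #|T A|%:R / 2 <= n * expR (- (D * #|A|%:R / (2 * n))).
      apply: (@le_trans _ _ (n * (1 + - (D * #|A|%:R / (2 * n))))).
        rewrite mulrDr mulr1 lerD2l mulrN lerN2.
        have -> : n * (D * #|A|%:R / (2 * n)) = D * #|A|%:R / 2.
          by field; rewrite gt_eqF.
        by rewrite ler_pM2r ?invr_gt0 ?ltr0n ?FT.
      by rewrite ler_pM2l // expR_ge1Dx.
    have h0 : 0 <= n - #|T A|%:R / 2.
      have : #|T A|%:R <= n by rewrite ler_nat max_card.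
      by have := ler0n R #|T A|; lra.
    have hK : (n - #|T A|%:R / 2) ^+ K <= (n * expR (- (D * #|A|%:R / (2 * n)))) ^+ K.
      by rewrite lerXn2r // nnegrE ?mulr_ge0 ?expR_ge0 ?ltW.
    apply: le_trans (ler_wpM2l _ hK) _; first by rewrite exprn_ge0.
    rewrite exprMn /q exprMn mulrCA ler_pM2l ?exprn_gt0 //.
    rewrite ler_pM2l ?exprn_gt0 // -!expRM_natl ler_expR le_eqVlt.
    by apply/orP; left; apply/eqP; field; rewrite gt_eqF.
  rewrite -mulr_sumr ler_pM2l ?exprn_gt0 // -sum_exp_card.
  (* The subtracted 1 is the term of the empty set, which [F] excludes. *)
  rewrite [leRHS](_ : _ = \sum_(A : {set V} | A != set0) q ^+ #|A|); last first.
    by rewrite (bigD1 set0) //= cards0 expr0 [1 + _]addrC addrK.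
  rewrite [leRHS](bigID F) /= -[leLHS]addr0 lerD //; last first.
    by apply: sumr_ge0 => A _; rewrite exprn_ge0 ?ltW.
  rewrite le_eqVlt; apply/orP; left; apply/eqP; apply: eq_bigl => A.
  by apply/idP/andP => [FA|[]//]; split=> //; exact: F0.
(* Hence [(1 + q) ^+ #|V| <= expR (n * q) <= expR 2^-1 < 2], so that [upper] and [lower] contradict
   each other. *)
have qn : n * q <= 2^-1 by move: hq; rewrite /q; lra.
have : (1 + q) ^+ #|V| < 2.
  apply: (@le_lt_trans _ _ (expR (n * q))).
    by rewrite expRM_natl lerXn2r // ?nnegrE ?expR_ge0 ?expR_ge1Dx // addr_ge0 // ltW.
  apply: (@le_lt_trans _ _ (expR 2^-1)); first by rewrite ler_expR.
  have : 1 - 2^-1 < expR (- 2^-1 : R)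
    by apply: expR_gt1Dx; rewrite oppr_eq0 invr_eq0 pnatr_eq0.
  rewrite expRN; have := expR_gt0 (2^-1 : R); set e := expR _ => e0.
  by rewrite -(ltr_pM2r e0) mulVf ?gt_eqF //; lra.
have := le_trans lower upper.
rewrite -[leLHS]mulr1 ler_pM2l ?exprn_gt0 //; lra.
Qed.

From mathcomp Require Import all_classical all_reals all_analysis.
Import numFieldNormedType.Exports.

(** * Expansion of balls, and the cop bound for a given radius *)

Section Expansion.
Variables (R : realType) (G : sgraph) (Delta : nat) (eps : R).
Hypothesis Delta_gt0 : (0 < Delta)%N.
Hypothesis degG : (max_degree G <= Delta)%N.
Hypothesis isoG : (eps%:E <= isoperimetric_number R G)%E.

Let lam : R := 1 + eps / Delta%:R.

(** At least [eps * #|S|] edges leave [S], and each vertex outside receives at most [Delta] of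
    them. *)
Lemma card_cnbhd_ge (S : {set G}) : (0 < #|S|)%N -> (2 * #|S| <= #|G|)%N ->
  lam * #|S|%:R <= #|cnbhd S|%:R.
Proof.
move=> S0 Shalf.
have : (eps%:E <= (#|edge_boundary S|%:R / #|S|%:R)%:E)%E.
  by apply: le_trans isoG _; apply: bigmin_le_cond; rewrite S0.
rewrite lee_fin ler_pdivlMr ?ltr0n // => hS.
have D0 : 0 < Delta%:R :> R by rewrite ltr0n.
have hD : eps * #|S|%:R <= Delta%:R * (#|cnbhd S|%:R - #|S|%:R).
  apply: (le_trans hS).
  rewrite -natrB ?subset_leq_card ?sub_cnbhd // -natrM ler_nat.
  have := card_edge_boundary S degG.
  by rewrite cardsD (finset.setIidPr (sub_cnbhd S)).
have -> : lam * #|S|%:R = #|S|%:R + eps * #|S|%:R / Delta%:R.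
  by rewrite /lam mulrDl mul1r mulrAC.
rewrite -lerBrDl ler_pdivrMr //; lra.
Qed.

(** Expansion applies as long as the neighbourhood has at most half of the vertices; past that size
    it stays there, because it never shrinks. *)
Lemma card_gball_ge (S : {set G}) (r : nat) : 0 <= lam -> (0 < #|S|)%N ->
  lam ^+ r * #|S|%:R <= #|gball S r|%:R \/ (#|G| < 2 * #|gball S r|)%N.
Proof.
move=> lam0 S0.
elim: r => [|r [IHr|IHr]]; first by left; rewrite expr0 mul1r.
  have [half|] := leqP (2 * #|gball S r|) #|G|.
    left; rewrite exprS -mulrA; apply: le_trans (ler_wpM2l lam0 IHr) _.
    apply: card_cnbhd_ge half.
    exact: leq_trans S0 (subset_leq_card (sub_gball _ _)).
  move=> big; right; apply: leq_trans big _.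
  by rewrite leq_mul2l subset_leq_card ?sub_cnbhd.
by right; apply: leq_trans IHr _; rewrite leq_mul2l subset_leq_card ?sub_cnbhd.
Qed.

End Expansion.

(* The hypothesis on r makes the ball of radius r around v so small that
   2 * D * #|A| <= #|G| for D := lam ^+ r / 6, hence also a set gball A r
   covering half of the graph is large enough. *)
Lemma card_gball_ge_radius (R : realType) (Delta : nat) (eps : R) (G : sgraph)
    (r : nat) (v : G) (A : {set G}) :
  let lam := 1 + eps / Delta%:R in
  (3 <= Delta)%N -> 0 < eps -> eps <= Delta%:R - 2 ->
  (max_degree G <= Delta)%N -> (eps%:E <= isoperimetric_number R G)%E ->
  (Delta.-1 ^ (2 * r) <= #|G|)%N ->
  A != finset.set0 -> A \subset gball [set v]%SET r ->
  lam ^+ r / 6 * #|A|%:R <= #|gball A r|%:R.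
Proof.
move=> lam D3 eps0 epsD degG isoG rG A0 sA.
have D0n : (0 < Delta)%N := ltnW (ltnW D3).
have D0 : 0 < Delta%:R :> R by rewrite ltr0n.
have Dge3 : 3 <= Delta%:R :> R by rewrite (ler_nat _ 3).
have lam1 : 1 <= lam by rewrite /lam lerDl divr_ge0 ?ltW.
have lamD : lam <= Delta%:R - 1.
  rewrite -lerBrDl ler_pdivrMr //; nra.
have mE : Delta%:R - 1 = Delta.-1%:R :> R by rewrite -subn1 natrB.
have A1 : (0 < #|A|)%N by rewrite card_gt0.
have lam0 : 0 <= lam by lra.
have lamr : 0 < lam ^+ r by rewrite exprn_gt0 //; lra.
have [big|big] := card_gball_ge D0n degG isoG r lam0 A1.
  by apply: le_trans big; rewrite ler_wpM2r //; lra.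
pose M : R := Delta.-1%:R ^+ r.
have lamM : lam ^+ r <= M by rewrite lerXn2r ?nnegrE //; lra.
have MG : M ^+ 2 <= #|G|%:R by rewrite -exprM mulnC -natrX ler_nat.
have cA : #|A|%:R <= 3 * M.
  rewrite /M -natrX -natrM ler_nat.
  exact: leq_trans (subset_leq_card sA) (card_gball v r D3 degG).
have cB : #|G|%:R <= 2 * #|gball A r|%:R :> R by rewrite -natrM ler_nat ltnW.
(* The 6 of the statement is this 3, from [card_gball], times the 2 of [cB]. *)
have h : lam ^+ r * #|A|%:R <= M * (3 * M) by rewrite ler_pM // ltW.
move: MG; rewrite expr2; lra.
Qed.

(** With [D := lam ^+ r / 6] the exponent in [random_placement] is [lam ^+ r * K / (12 * #|G|)],
    which has to reach [ln (4 * #|G|)]. *)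
Lemma cop_number_le_radius (R : realType) (Delta : nat) (eps : R) (G : sgraph)
    (r K : nat) :
  let lam := 1 + eps / Delta%:R in
  (3 <= Delta)%N -> 0 < eps -> eps <= Delta%:R - 2 ->
  (max_degree G <= Delta)%N -> (eps%:E <= isoperimetric_number R G)%E ->
  (0 < #|G|)%N -> (Delta.-1 ^ (2 * r) <= #|G|)%N ->
  12 * #|G|%:R * ln (4 * #|G|%:R) / lam ^+ r <= K%:R ->
  (cop_number G <= K)%N.
Proof.
move=> lam D3 eps0 epsD degG isoG G0 rG hK.
have n0 : 0 < #|G|%:R :> R by rewrite ltr0n.
have lamr : 0 < lam ^+ r by rewrite exprn_gt0 // addr_gt0 ?divr_gt0 // ltr0n ltnW // ltnW.
(* The cops are placed before the robber, so the Hall conditions of all balls must hold at once. *)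
pose F (A : {set G}) := (A != finset.set0) && [exists v, A \subset gball [set v]%SET r].
have [||||c cP] := @random_placement R G F (fun A => gball A r) (lam ^+ r / 6) K.
- by [].
- by move=> A /andP[].
- move=> A /andP[A0 /existsP[v sA]].
  exact: card_gball_ge_radius D3 eps0 epsD degG isoG rG A0 sA.
- have : expR (- (lam ^+ r / 6 * K%:R / (2 * #|G|%:R))) <= expR (- ln (4 * #|G|%:R) : R).
    rewrite ler_expR lerN2 ler_pdivlMr ?mulr_gt0 //.
    by move: hK; rewrite ler_pdivrMr //; lra.
  rewrite [X in _ <= X -> _]expRN lnK ?posrE ?mulr_gt0 // => h.
  by rewrite mulrC -ler_pdivlMr ?mulr_gt0 // mul1r.
apply: cop_number_le; apply: (@cops_win_of_placement G r K c) => v A sA.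
have [->|A0] := eqVneq A finset.set0; first by rewrite cards0.
by apply: cP; rewrite /F A0; apply/existsP; exists v.
Qed.

(** * Choice of the radius and numerical estimates *)

Lemma ln_ge_half (R : realType) (x : R) : 2 <= x -> 1 / 2 <= ln x.
Proof.
move=> x2; have x0 : 0 < x by lra.
have : ln x^-1 <= x^-1 - 1.
  have i0 : 0 < x^-1 by rewrite invr_gt0.
  by have := @le_ln1Dx R (x^-1 - 1); rewrite [1 + _]addrC subrK; apply; lra.
have : x^-1 <= 2^-1 by rewrite lef_pV2 ?posrE.
rewrite lnV ?posrE //; lra.
Qed.

Lemma logb_bounds (R : realType) (m x : R) : 1 < m -> 1 <= x -> x <= m ->
  0 <= logb m x <= 1.
Proof.
move=> m1 x1 xm; have lnm : 0 < ln m by rewrite ln_gt0.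
apply/andP; split; first exact: divr_ge0 (ln_ge0 x1) (ltW lnm).
rewrite /logb ler_pdivrMr // mul1r ler_ln ?posrE //; lra.
Qed.

(** Since [r + 1] exceeds half the logarithm of [n] in base [m], [lam ^+ r.+1] is at least [n] to
    the power [2^-1 * logb m lam]; going back to [r] costs a factor [lam <= 2]. The added 1 leaves
    room for rounding the number of cops. *)
Lemma radius_bound (R : realType) (n m lam : R) (r : nat) :
  2 <= n -> 2 <= m -> 1 <= lam -> lam <= 2 -> n < m ^+ (2 * r.+1) ->
  12 * n * ln (4 * n) / lam ^+ r + 1
    <= 78 * ln n * n `^ (1 - 2^-1 * logb m lam).
Proof.
move=> n2 m2 lam1 lam2 rgt.
have n0 : 0 < n by lra.
have m0 : 0 < m by lra.
have m1 : 1 < m by lra.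
have lam0 : 0 < lam by lra.
have lnm0 : 0 < ln m by rewrite ln_gt0.
have /andP[lb0 lb1] := logb_bounds m1 lam1 (le_trans lam2 m2).
have ln4n := @ln_ge_half R (4 * n) ltac:(lra).
have ln3 : ln (4 * n) <= 3 * ln n.
  rewrite [leRHS]mulr_natl -lnXn // ler_ln ?posrE ?exprn_gt0 ?mulr_gt0 //.
  by rewrite exprSr ler_wpM2r ?(ltW n0) // expr2; nra.
set e := 2^-1 * _.
have lam_ge : n `^ e <= lam ^+ r.+1.
  rewrite /powR gt_eqF // -[lam in leRHS]lnK ?posrE // -expRM_natl ler_expR.
  have : ln n <= (2 * r.+1)%:R * ln m.
    by rewrite [leRHS]mulr_natl -lnXn // ler_ln ?posrE ?exprn_gt0 // ltW.
  have e0 : 0 <= e by rewrite /e; lra.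
  move/(ler_wpM2l e0)/le_trans; apply.
  rewrite /e /logb natrM le_eqVlt; apply/orP; left; apply/eqP.
  by field; rewrite gt_eqF.
have ne0 : 0 < n `^ e by rewrite powR_gt0.
have lamr0 : 0 < lam ^+ r by rewrite exprn_gt0.
have Y1 : 1 <= n `^ (1 - e).
  by rewrite -[leLHS](powRr0 n) ler_powR // /e; lra.
have Ydiv : n `^ (1 - e) = n / n `^ e.
  by rewrite powRD ?(gt_eqF n0) ?implybT // powRN powRr1 // ltW.
have h : (lam ^+ r)^-1 <= 2 / n `^ e.
  rewrite ler_pdivlMr // ler_pdivrMl //.
  by apply: le_trans lam_ge _; rewrite exprSr ler_wpM2l // ltW.
have c0 : 0 <= 12 * n * ln (4 * n) by rewrite !mulr_ge0 ?(ltW n0) //; lra.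
have yle : 12 * n * ln (4 * n) / lam ^+ r <= 24 * ln (4 * n) * n `^ (1 - e).
  by apply: le_trans (ler_wpM2l c0 h) _; rewrite Ydiv; lra.
(* Here 78 is 24 * 3 + 6: [ln4n] and [ln3] give [1 <= 6 * ln n], which absorbs the added 1. *)
move: yle Y1 ln4n ln3; clear; nra.
Qed.

Lemma cop_number_expander (R : realType) (Delta : nat) (eps : R) (G : sgraph) :
  (3 <= Delta)%N -> 0 < eps -> eps <= Delta%:R - 2 ->
  (max_degree G <= Delta)%N -> (1 < #|G|)%N ->
  (eps%:E <= isoperimetric_number R G)%E ->
  (cop_number G)%:R <= 78 * ln (#|G|%:R : R) *
    #|G|%:R `^ (1 - 2^-1 * logb (Delta%:R - 1) (1 + eps / Delta%:R)).
Proof.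
move=> D3 eps0 epsD degG n1 isoG.
have G0 : (0 < #|G|)%N := ltnW n1.
have Dge3 : 3 <= Delta%:R :> R by rewrite (ler_nat _ 3).
have D0 : 0 < Delta%:R :> R by lra.
set n : R := #|G|%:R; set lam := 1 + eps / Delta%:R; set m : R := Delta%:R - 1.
have lam1 : 1 <= lam by rewrite /lam lerDl divr_ge0 ?ltW.
have lam2 : lam <= 2.
  by rewrite /lam (_ : 2 = 1 + 1) // lerD2l ler_pdivrMr //; lra.
have m2 : 2 <= m by rewrite /m; lra.
have mE : m = Delta.-1%:R by rewrite /m -subn1 natrB // ltnW // ltnW.
have n2 : 2 <= n by rewrite (ler_nat _ 2).
(* The largest [r] with [Delta.-1 ^ (2 * r) <= #|G|]: [rle] keeps balls small, and maximality
   ([rgt]) makes [lam ^+ r] large. *)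
pose r := trunc_log (Delta.-1 ^ 2) #|G|.
have D2 : (1 < Delta.-1)%N by rewrite -ltnS (ltn_predK D3).
have p1 : (1 < Delta.-1 ^ 2)%N by rewrite -(exp1n 2) ltn_exp2r.
have rle : (Delta.-1 ^ (2 * r) <= #|G|)%N by rewrite expnM trunc_logP.
have rgt : n < m ^+ (2 * r.+1).
  by rewrite mE -natrX ltr_nat expnM trunc_log_ltn.
apply: le_trans (radius_bound n2 m2 lam1 lam2 rgt).
set y := 12 * n * _ / _.
have y0 : 0 <= y.
  have := @ln_ge_half R (4 * n) ltac:(lra).
  by move=> h; rewrite divr_ge0 ?exprn_ge0 ?mulr_ge0 ?ler0n //; lra.
have /andP[yK Ky] := truncn_itv y0.
apply: (@le_trans _ _ (Num.truncn y).+1%:R); last by rewrite -natr1 lerD2r.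
by rewrite ler_nat; apply: cop_number_le_radius rle (ltW Ky).
Qed.

(** * The error term in the exponent *)

Section Asymptotics.
Local Open Scope classical_set_scope.

Lemma inv_sqrt_ln_cvg0 (R : realType) (c : R) (N : nat) (a : R) : 0 < c ->
  (fun n : nat => if (n <= N)%N then a else c / Num.sqrt (ln n%:R)) @ \oo --> (0 : R).
Proof.
move=> c0; apply/cvgrPdist_lt => e e0.
near=> n.
have nN : (N < n)%N by near: n; exists N.+1.
rewrite leqNgt nN /= sub0r normrN.
have en : expR ((c / e) ^+ 2) < n%:R by near: n; exact: nbhs_infty_gtr.
have n0 : 0 < n%:R :> R by apply: lt_trans en; exact: expR_gt0.
have lnn : (c / e) ^+ 2 < ln n%:R.
  by rewrite -[X in X < _]expRK ltr_ln ?posrE ?expR_gt0.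
have ce : c / e < Num.sqrt (ln n%:R).
  have ce0 : 0 <= c / e by rewrite ltW ?divr_gt0.
  by rewrite -(ger0_norm ce0) -sqrtr_sqr ltr_sqrt // (le_lt_trans (sqr_ge0 _) lnn).
have s0 : 0 < Num.sqrt (ln n%:R) :> R by apply: lt_trans ce; rewrite divr_gt0.
rewrite ger0_norm ?divr_ge0 ?ltW // ltr_pdivrMr // mulrC -ltr_pdivrMr //.
Unshelve. all: end_near.
Qed.

End Asymptotics.

Local Open Scope classical_set_scope.

Theorem corollary4p7 (R : realType) (Delta : nat) (hDelta : (3 <= Delta)%N)
  (family : sgraph -> Prop)
  (hconn : forall G : sgraph, family G -> connected_graph G)
  (hdeg : forall G : sgraph, family G -> (max_degree G <= Delta)%N)
  (eps : R) (heps0 : 0 < eps) (heps : eps <= Delta%:R - 2)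
  (hiso : exists N : nat, forall G : sgraph, family G -> (N < graph_order G)%N ->
            (eps%:E <= isoperimetric_number R G)%E) :
  exists f : nat -> R, f n @[n --> \oo] --> (0 : R) /\
    forall G : sgraph, family G ->
      (cop_number G)%:R <=
        (graph_order G)%:R `^
          (1 - 2^-1 * logb (Delta%:R - 1) (1 + eps / Delta%:R) + f (graph_order G)).
Proof.
have [N hN] := hiso.
set e := 2^-1 * logb _ _.
(* For small [n] the value [e] makes the exponent 1, so the trivial bound suffices; [maxn N 1] also
   keeps [ln n] positive in the other case. *)
exists (fun n => if (n <= maxn N 1)%N then e else 18 / Num.sqrt (ln n%:R)); split.
  exact: inv_sqrt_ln_cvg0.
move=> G fG; have [G0 _] := hconn G fG; set n := graph_order G.
have [small|] := leqP n (maxn N 1).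
  by rewrite subrK powRr1 ?ler0n // ler_nat cop_number_le_order.
rewrite gtn_max => /andP[Nn n1].
have n0 : 0 < n%:R :> R by rewrite ltr0n ltnW.
have L0 : 0 < ln n%:R :> R by rewrite ln_gt0 // ltr1n.
rewrite powRD ?(gt_eqF n0) ?implybT //.
apply: le_trans (cop_number_expander hDelta heps0 heps (hdeg G fG) n1 (hN G fG Nn)) _.
rewrite mulrC ler_wpM2l ?powR_ge0 //.
rewrite /powR gt_eqF // mulrAC -[X in _ * X / _](sqr_sqrtr (ltW L0)).
rewrite expr2 mulrA mulfK ?gt_eqF ?sqrtr_gt0 //.
have s0 : 0 <= Num.sqrt (ln n%:R) :> R by rewrite sqrtr_ge0.
(* The quadratic term of the exponential is [18 ^ 2 / 2 * ln n], that is [162 * ln n], which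
   dominates the factor [78 * ln n]. *)
have := @expR_ge1Dxn R (18 * Num.sqrt (ln n%:R)) 1 ltac:(lra).
have -> : (2`!)%:R = 2 :> R by [].
rewrite exprMn sqr_sqrtr; last exact: ltW.
lra.
Qed.
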